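(* Let $\|\cdot\|$ be a norm on $\mathbb{R}^d$ that is strictly convex and differentiable away from $0$, and let $(x_s,y_s)_{s\ge 1}$ be a data stream in $\mathbb{R}^d\times\{\pm1\}$ satisfying the separability and boundedness assumptions stated in the context, with $\gamma_*$, $D$ and $r=D/\gamma_*$ as defined there. Fix $\rho\in[0,1]$. Then the Online Maximum Margin algorithm with aggressiveness parameter $\rho$ (in either its naive or its efficient implementation) satisfies, simultaneously for all $\phi\le\rho$ (with $\phi<1$, as required in the definition of $m(\phi)$), $$ m(\phi)\;\le\;\begin{cases} 0, & \text{if } \phi<1-r,\\[4pt] \dfrac{\log(\gamma_3/\gamma_* )}{-\log(\kappa(r,\phi))}, & \text{if } \phi\ge 1-r.\end{cases}$$
   Context: **Norms.** $\|\cdot\|$ is a norm on $\mathbb{R}^d$ ($d\ge1$) with dual norm $\|\cdot\|_*$. It is strictly convex (its unit ball is strictly convex, i.e. $\|x+y\|<\|x\|+\|y\|$ unless one of $x,y$ is a nonnegative multiple of the other) and differentiable away from $0$; consequently the same holds for $\|\cdot\|_*$. For $x\neq0$, $\ell(x):=\nabla\|x\|$ is the gradient of the norm at $x$. **Margin.** For $(x,y)\in\mathbb{R}^d\times\{\pm1\}$ and a linear classifier $(w,b)\in\mathbb{R}^d\times\mathbb{R}$, $w\ne0$, set $\gamma(x,y;w,b):=\max\{0,\,y(w^\top x+b)\}/\|w\|_*$. For finite sets $V_+,V_-\subset\mathbb{R}^d$ that are linearly separable (some $(w,b)$ has $w^\top v+b>0$ on $V_+$ and $w^\top v+b<0$ on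 $V_-$), with labels $y(v)=+1$ on $V_+$ and $y(v)=-1$ on $V_-$, set $$\gamma(V_+,V_-):=\max_{w,b}\ \min_{v\in V_+\cup V_-}\gamma(v,y(v);w,b).$$ The *dual certificates* of $\gamma(V_+,V_-)$ are points $v_+\in\operatorname{conv}(V_+)$, $v_-\in\operatorname{conv}(V_-)$ minimizing $\|v_+-v_-\|$ over $\operatorname{conv}(V_+)\times\operatorname{conv}(V_-)$. **Assumptions on the stream.** The stream is a sequence $(x_s,y_s)_{s\ge1}$ in $\mathbb{R}^d\times\{\pm1\}$ in which both labels occur. With $\operatorname{sign}(0)=1$, there is a classifier $(w_*,b_* )$ with $y_s=\operatorname{sign}(w_*^\top x_s+b_* )$ for all $s$ which, among all such correct classifiers, has the largest margin $\gamma_*:=\inf_s\gamma(x_s,y_s;w_*,b_* )$, and $\gamma_*>0$. Moreover $D_+:=\sup\{\|x_s-x_{s'}\|:y_s=y_{s'}=+1\}$, $D_-:=\sup\{\|x_s-x_{s'}\|:y_s=y_{s'}=-1\}$ and $\sup_s\|x_s\|$ are finite. Put $D:=\max\{D_+,D_-\}$ and $r:=D/\gamma_*$. **Online Maximum Margin algorithm with aggressiveness parameter $\rho\in[0,1]$.** *Initialization:* read the stream until both labels have been seen; keep only the first point of the stream and the first point with the opposite label. Let $v_{3,+}$ be the kept point with label $+1$ and $v_{3,-}$ the one with label $-1$; set $V_{3,+}=\{v_{3,+}\}$, $V_{3,-}=\{v_{3,-}\}$, $\gamma_3:=\gamma(V_{3,+},V_{3,-})$, $w_3:=\ell(v_{3,+}-v_{3,-})$,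 $b_3:=-\tfrac12w_3^\top(v_{3,+}+v_{3,-})$. The iteration counter is reset, so that the stream points received after initialization are denoted, in order, $(x_t,y_t)$, $t=3,4,\dots$. *Iteration $t\ge3$:* receive $x_t$, predict $\operatorname{sign}(w_t^\top x_t+b_t)$, receive $y_t$, and let $a_t:=y_t(w_t^\top x_t+b_t)$. If $a_t<\rho\gamma_t$ (update): in the naive implementation, add $x_t$ to the set of its label, i.e. $V_{t+1,+}=V_{t,+}\cup\{x_t\}$, $V_{t+1,-}=V_{t,-}$ if $y_t=+1$, and $V_{t+1,+}=V_{t,+}$, $V_{t+1,-}=V_{t,-}\cup\{x_t\}$ if $y_t=-1$; in the efficient implementation, $V_{t+1,+}=\{v_{t,+},x_t\}$, $V_{t+1,-}=\{v_{t,-}\}$ if $y_t=+1$, and $V_{t+1,+}=\{v_{t,+}\}$, $V_{t+1,-}=\{v_{t,-},x_t\}$ if $y_t=-1$. Then let $v_{t+1,+},v_{t+1,-}$ be dual certificates of $\gamma_{t+1}:=\gamma(V_{t+1,+},V_{t+1,-})$, and set $w_{t+1}:=\ell(v_{t+1,+}-v_{t+1,-})$, $b_{t+1}:=-\tfrac12w_{t+1}^\top(v_{t+1,+}+v_{t+1,-})$. Otherwise all quantities ($V_{\cdot,\pm},v_{\cdot,\pm},w,b,\gamma$) are carried over unchanged from $t$ to $t+1$. **Violation count.** For $\phi<1$, $m(\phi):=\#\{t\ge3:\ \gamma(x_t,y_t;w_t,b_t)\le\phi\gamma_t\}$. **The functions $\kappa_\circ$ and $\kappa$.** For $\delta,\eta\in\mathbb{R}$,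 $$\kappa_\circ(\delta,\eta):=\max_{u,z\in\mathbb{R}^d}\Big\{\min_{\beta\in[0,1]}\|u-\beta z\|:\ \|u\|=1,\ \|z\|\le\delta,\ \ell(u)^\top z\ge\eta\Big\},$$ with value $-\infty$ if there is no feasible $(u,z)$; and $\kappa(r,\phi):=\kappa_\circ\big(r/2,(1-\phi)/2\big)$. If $\kappa(r,\phi)=0$, the quotient by $-\log\kappa(r,\phi)=+\infty$ is read as $0$.
   Formalization: In the case φ = ρ it is additionally assumed that no received point has a_t = ργ_t exactly; such a point is a violation that triggers no update and may recur forever, making m(ρ) infinite. For φ < ρ nothing is added. *)

(* Defs.v *)
From HB Require Import structures.
From mathcomp Require Import all_boot all_order all_algebra.
From mathcomp Require Import all_classical all_reals all_analysis.

Set Implicit Arguments.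
Unset Strict Implicit.
Unset Printing Implicit Defensive.

Import Order.TTheory GRing.Theory Num.Theory.
Import numFieldNormedType.Exports.

Local Open Scope classical_set_scope.
Local Open Scope ring_scope.

Section norms.
Context {R : realType} {d : nat}.
Implicit Types (N : 'rV[R]_d -> R) (V : set 'rV[R]_d) (u v w x z : 'rV[R]_d).

(* An arbitrary norm N on R^d is a plain function, because 'rV[R]_d already
   carries the canonical sup norm `|x|.  The topology (hence differentiability)
   is that of the sup norm; all norms on R^d induce the same one. *)
Record is_norm N : Prop := IsNorm {
  norm_triangle : forall x y, N (x + y) <= N x + N y;
  norm_homogeneous : forall (c : R) x, N (c *: x) = `|c| * N x;
  norm_definite : forall x, N x = 0 -> x = 0 }.

Definition strictly_convex_norm N : Prop := forall x y,
  ~ (exists2 c : R, 0 <= c & x = c *: y \/ y = c *: x) ->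
  N (x + y) < N x + N y.

Definition differentiable_off0 N : Prop :=
  forall x, x != 0 -> differentiable N x.

Definition dot w x : R := \sum_(i < d) w 0 i * x 0 i.

Definition dual_norm N w : R := sup [set dot w x | x in [set x | N x <= 1]].

(* gradient of N at x, as the row of partial derivatives *)
Definition ell N x : 'rV[R]_d := \row_i 'D_(delta_mx 0 i) N x.

Definition conv_hull V : set 'rV[R]_d :=
  smallest (fun A : set 'rV[R]_d => convex_set A) V.

(* +1 and -1 as real numbers; sign 0 = 1, unlike Num.sg *)
Definition sign (a : R) : R := if 0 <= a then 1 else -1.

Definition margin N x (y : R) w (b : R) : R :=
  Num.max 0 (y * (dot w x + b)) / dual_norm N w.

Definition labelled_margins N (Vp Vm : set 'rV[R]_d) w b : set R :=
  [set margin N v 1 w b | v in Vp] `|` [set margin N v (-1) w b | v in Vm].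

(* gamma(V+, V-).  For finite nonempty V+ and V-, the only ones the algorithm
   produces, the infimum is a minimum; if they are separable, the supremum is
   a maximum. *)
Definition set_margin N (Vp Vm : set 'rV[R]_d) : R :=
  sup [set inf (labelled_margins N Vp Vm c.1 c.2)
      | c in [set c : 'rV[R]_d * R | c.1 != 0]].

Definition dual_certificates N (Vp Vm : set 'rV[R]_d) vp vm : Prop :=
  [/\ conv_hull Vp vp, conv_hull Vm vm &
      forall p q, conv_hull Vp p -> conv_hull Vm q -> N (vp - vm) <= N (p - q)].

(* The supremum in \bar R over an empty feasible set is -oo. *)
Definition kappa_circ N (delta eta : R) : \bar R :=
  ereal_sup [set (inf [set N (c.1 - beta *: c.2)
                      | beta in `[0 : R, 1]%classic])%:E
            | c in [set c : 'rV[R]_d * 'rV[R]_d |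
                     [/\ N c.1 = 1, N c.2 <= delta & eta <= dot (ell N c.1) c.2]]].

Definition kappa N (r phi : R) : \bar R := kappa_circ N (r / 2) ((1 - phi) / 2).

End norms.

(* Streams are indexed from 0: x s and y s are the (s+1)-st point and label. *)
Section streams.
Context {R : realType} {d : nat}.
Implicit Types (N : 'rV[R]_d -> R) (x : nat -> 'rV[R]_d) (y : nat -> R).

Definition correct_classifier x y (w : 'rV[R]_d) (b : R) : Prop :=
  w != 0 /\ forall s, y s = sign (dot w (x s) + b).

Definition stream_margin N x y (w : 'rV[R]_d) (b : R) : R :=
  inf (range (fun s => margin N (x s) (y s) w b)).

Definition max_margin_classifier N x y (w : 'rV[R]_d) (b : R) : Prop :=
  correct_classifier x y w b /\
  forall w' b', correct_classifier x y w' b' ->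
    stream_margin N x y w' b' <= stream_margin N x y w b.

Definition label_dists N x y (l : R) : set R :=
  [set N (x s.1 - x s.2)
  | s in [set s : nat * nat | y s.1 = l /\ y s.2 = l]].

Definition label_diam N x y (l : R) : R := sup (label_dists N x y l).

Definition stream_diam N x y : R :=
  Num.max (label_diam N x y 1) (label_diam N x y (-1)).

(* s0 is the first index at which both labels have been seen. *)
Definition first_opposite y (s0 : nat) : Prop :=
  y s0 <> y 0%N /\ forall s, (s < s0)%N -> y s = y 0%N.

(* After initialization the stream is re-indexed so that the first point
   received, the one at index s0 + 1, gets number t = 3. *)
Definition received (T : Type) (s0 : nat) (f : nat -> T) (t : nat) : T :=
  f (s0 + (t - 2))%N.

End streams.

Section algorithm.
Context {R : realType} {d : nat}.
Implicit Types (N : 'rV[R]_d -> R) (x : nat -> 'rV[R]_d) (y : nat -> R).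

Inductive implementation : Set := Naive | Efficient.

Record state := State {
  st_Vp : set 'rV[R]_d; st_Vm : set 'rV[R]_d;
  st_vp : 'rV[R]_d; st_vm : 'rV[R]_d;
  st_w : 'rV[R]_d; st_b : R; st_gamma : R }.

Definition build_state N (Vp Vm : set 'rV[R]_d) (vp vm : 'rV[R]_d) : state :=
  let w := ell N (vp - vm) in
  State Vp Vm vp vm w (- (2^-1 * dot w (vp + vm))) (set_margin N Vp Vm).

Definition init_state N x y (s0 : nat) : state :=
  let vp := if y 0%N == 1 then x 0%N else x s0 in
  let vm := if y 0%N == 1 then x s0 else x 0%N in
  build_state N [set vp] [set vm] vp vm.

Definition new_sets (impl : implementation) (st : state) (xt : 'rV[R]_d)
    (yt : R) : set 'rV[R]_d * set 'rV[R]_d :=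
  let: (Ap, Am) := match impl with
    | Naive => (st_Vp st, st_Vm st)
    | Efficient => ([set st_vp st], [set st_vm st])
    end in
  if yt == 1 then (Ap `|` [set xt], Am) else (Ap, Am `|` [set xt]).

Definition score (st : state) (xt : 'rV[R]_d) (yt : R) : R :=
  yt * (dot (st_w st) xt + st_b st).

(* A relation rather than a function: dual certificates need not be unique. *)
Definition step N (impl : implementation) (rho : R) (st : state)
    (xt : 'rV[R]_d) (yt : R) (st' : state) : Prop :=
  if score st xt yt < rho * st_gamma st then
    let V := new_sets impl st xt yt in
    exists vp vm, dual_certificates N V.1 V.2 vp vm /\
                  st' = build_state N V.1 V.2 vp vm
  else st' = st.

(* st t is the state at the start of iteration t; only t >= 3 matters. *)
Definition omm_run N (impl : implementation) (rho : R) x y (s0 : nat)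
    (st : nat -> state) : Prop :=
  st 3%N = init_state N x y s0 /\
  forall t, (3 <= t)%N ->
    step N impl rho (st t) (received s0 x t) (received s0 y t) (st t.+1).

(* Cardinality in \bar R, +oo if there are infinitely many violations. *)
Definition violations N x y (s0 : nat) (st : nat -> state) (phi : R) : \bar R :=
  counting [set t : nat | (3 <= t)%N /\
    margin N (received s0 x t) (received s0 y t) (st_w (st t)) (st_b (st t))
      <= phi * st_gamma (st t)].

(* score = rho * gamma triggers no update, yet it is a violation at level
   phi = rho; such a point may recur forever. *)
Definition no_ties (rho : R) x y (s0 : nat) (st : nat -> state) : Prop :=
  forall t, (3 <= t)%N ->
    score (st t) (received s0 x t) (received s0 y t) <> rho * st_gamma (st t).

(* In \bar R, lne 0 = -oo and (+oo)^-1 = 0, so the quotient is 0 when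
   kappa = 0. *)
Definition violation_bound N (r gamma3 gamma_star phi : R) : \bar R :=
  if phi < 1 - r then 0%E
  else ((ln (gamma3 / gamma_star))%:E / - lne (kappa N r phi))%E.

End algorithm.

(* Main.v *)
Require Import Defs.
From HB Require Import structures.
From mathcomp Require Import all_boot all_order all_algebra.
From mathcomp Require Import all_classical all_reals all_analysis.
From mathcomp Require Import lra.

Set Implicit Arguments.
Unset Strict Implicit.
Unset Printing Implicit Defensive.

Import Order.TTheory GRing.Theory Num.Theory.
Import numFieldNormedType.Exports.

Local Open Scope classical_set_scope.
Local Open Scope ring_scope.

(** The potential is the margin gamma_t of the retained points.  By duality
    (set_margin_certificates) it is half the distance N (v+ - v-) between the
    two current hulls, and it never drops below gamma_star: the hulls stay
    inside the hulls of the positive and of the negative stream points, and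
    these lie on opposite sides of a slab of N-width 2 gamma_star around the
    separator of the stream (margin_separates, stream_gap).

    The gradient w of N at p = v+ - v- has dual norm 1 and satisfies
    w.p = N p, so the score of a labelled point is gamma_t - w.z, where z is
    the displacement from the certificate of its label, oriented so that
    p - b z, for b in [0, 1], is a difference of points of the updated hulls
    (certified_score, step_update).  A violation at level phi therefore means
    w.z >= (1 - phi) gamma_t, and N z <= D.  Since w.z <= N z and
    gamma_star <= gamma_t, it forces 1 - phi <= D / gamma_star = r, which
    settles the case phi < 1 - r (violation_diam).  It also forces an update
    (in the absence of ties when phi = rho), after which the distance is at
    most the minimum of N (p - b z) over b.  Dividing p and z by
    N p = 2 gamma_t gives a feasible pair for kappa r phi, because the
    gradient does not change under positive scaling; hence gamma_(t+1) <= kappa gamma_t (le_kappa, violation_contraction).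

    So ln (gamma_t / gamma_star) is nonnegative, nonincreasing, starts at
    ln (gamma_3 / gamma_star) and loses at least - ln kappa at each violation:
    the number of violations is at most the quotient (descent_count).  When
    kappa = 1 the denominator vanishes and the bound is +oo if
    gamma_3 > gamma_star, but 0 if gamma_3 = gamma_star.  Since w.z > 0, a
    violation strictly decreases gamma_t (norm_descent), so it can only occur
    in the former case. *)

(** * The dot product *)

Section dot_product.
Context {R : realType} {d : nat}.
Implicit Types (w x y : 'rV[R]_d) (a : R).

Lemma dotDr w x y : dot w (x + y) = dot w x + dot w y.
Proof. by rewrite -big_split/=; apply: eq_bigr => i _; rewrite mxE mulrDr. Qed.

Lemma dotZr w a x : dot w (a *: x) = a * dot w x.
Proof. by rewrite mulr_sumr; apply: eq_bigr => i _; rewrite mxE mulrCA. Qed.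

Lemma dotNr w x : dot w (- x) = - dot w x.
Proof. by rewrite -scaleN1r dotZr mulN1r. Qed.

Lemma dotBr w x y : dot w (x - y) = dot w x - dot w y.
Proof. by rewrite dotDr dotNr. Qed.

Lemma dot0r w : dot w 0 = 0.
Proof. by rewrite -(scale0r 0) dotZr mul0r. Qed.

Lemma dotNl w x : dot (- w) x = - dot w x.
Proof. by rewrite -sumrN; apply: eq_bigr => i _; rewrite mxE mulNr. Qed.

Lemma dot0l x : dot 0 x = 0.
Proof. by rewrite /dot big1// => i _; rewrite mxE mul0r. Qed.

End dot_product.

(** * Arbitrary norms on row vectors *)

Section norm_basics.
Context {R : realType} {d : nat} {N : 'rV[R]_d -> R}.
Hypothesis N_norm : is_norm N.

Lemma norm0 : N 0 = 0.
Proof. by rewrite -(scale0r 0) (norm_homogeneous N_norm) normr0 mul0r. Qed.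

Lemma normN x : N (- x) = N x.
Proof. by rewrite -scaleN1r (norm_homogeneous N_norm) normrN1 mul1r. Qed.

Lemma norm_ge0 x : 0 <= N x.
Proof.
have := norm_triangle N_norm x (- x).
by rewrite subrr norm0 normN; lra.
Qed.

Lemma norm_eq0 x : (N x == 0) = (x == 0).
Proof.
by apply/eqP/eqP => [/(norm_definite N_norm)//|->]; exact: norm0.
Qed.

Lemma norm_gt0 x : (0 < N x) = (x != 0).
Proof. by rewrite lt_def norm_ge0 andbT norm_eq0. Qed.

Lemma normZ_ge0 a x : 0 <= a -> N (a *: x) = a * N x.
Proof. by move=> a0; rewrite (norm_homogeneous N_norm) ger0_norm. Qed.

End norm_basics.

(** * Convex hulls *)

Section convex_hulls.
Context {R : realType} {d : nat}.
Implicit Types (A V W : set 'rV[R]_d) (p q v w x : 'rV[R]_d) (N : 'rV[R]_d -> R).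

(** Replaces the type of reals of the unit interval, over which convex_set
    quantifies, by an explicit bound. *)
Lemma convex_setP A : convex_set A <->
  forall p q (t : R), 0 <= t <= 1 -> A p -> A q -> A (t *: p + (1 - t) *: q).
Proof.
split=> [cA p q t /andP[t0 t1] Ap Aq|cA p q l /set_mem Ap /set_mem Aq].
  by have /set_mem := cA p q (Itv01 t0 t1) (mem_set Ap) (mem_set Aq).
by apply/mem_set; apply: cA => //; rewrite ge0 le1.
Qed.

Lemma conv_hull_convex V : convex_set (conv_hull V).
Proof.
apply/convex_setP => p q t t01 Vp Vq A [cA VA].
move/convex_setP: (cA); apply => //; [exact: Vp|exact: Vq].
Qed.

Lemma conv_hull_segment V p q (t : R) : 0 <= t <= 1 ->
  conv_hull V p -> conv_hull V q -> conv_hull V (p + t *: (q - p)).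
Proof.
move=> t01 Vp Vq.
have /convex_setP/(_ q p t t01 Vq Vp) := conv_hull_convex (V := V).
by rewrite scalerBl scale1r addrCA -scalerBr.
Qed.

Lemma conv_hull_min V A : convex_set A -> V `<=` A -> conv_hull V `<=` A.
Proof. exact: smallest_sub. Qed.

Lemma sub_conv_hull V : V `<=` conv_hull V.
Proof. exact: sub_gen_smallest. Qed.

Lemma conv_hullS V W : V `<=` conv_hull W -> conv_hull V `<=` conv_hull W.
Proof. by move=> VW; apply: conv_hull_min => //; exact: conv_hull_convex. Qed.

Lemma halfspace_convex w (c : R) : convex_set [set v | c <= dot w v].
Proof.
apply/convex_setP => p q t /andP[t0 t1] /= cp cq.
rewrite dotDr !dotZr; nra.
Qed.

Lemma norm_ball_convex N x (c : R) :
  is_norm N -> convex_set [set v | N (v - x) <= c].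
Proof.
move=> N_norm; apply/convex_setP => p q t /andP[t0 t1] /= cp cq.
have -> : t *: p + (1 - t) *: q - x = t *: (p - x) + (1 - t) *: (q - x).
  rewrite !scalerBr addrACA -opprD -scalerDl.
  by rewrite addrCA subrr addr0 scale1r.
apply: (le_trans (norm_triangle N_norm _ _)).
rewrite !(normZ_ge0 N_norm) ?subr_ge0//.
by nra.
Qed.

Lemma conv_hull1 x v : conv_hull [set x] v -> v = x.
Proof.
move: v; apply: conv_hull_min => [|v ->//].
apply/convex_setP => p q t _ -> ->.
by rewrite -scalerDl addrCA subrr addr0 scale1r.
Qed.

(** A ball is convex, so one that contains V contains its hull. *)
Lemma conv_hull_diam N V (c : R) : is_norm N ->
  (forall p q, V p -> V q -> N (p - q) <= c) ->
  forall p q, conv_hull V p -> V q -> N (p - q) <= c.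
Proof.
move=> N_norm Vc p q + Vq; move: p.
apply: (@conv_hull_min _ [set p | N (p - q) <= c]) => [|p Vp]; last exact: Vc.
exact: norm_ball_convex.
Qed.

End convex_hulls.

(** * The gradient of a norm *)

Section gradient_of_norm.
Context {R : realType} {d : nat} {N : 'rV[R]_d -> R}.
Hypotheses (N_norm : is_norm N) (N_diff : differentiable_off0 N).
Implicit Types p z : 'rV[R]_d.

Lemma dot_ellE p z : p != 0 -> dot (ell N p) z = 'D_z N p.
Proof.
move=> p0; have dp := N_diff p0.
rewrite deriveE// [in RHS](row_sum_delta z) linear_sum; apply: eq_bigr => i _.
by rewrite linearZ mxE deriveE// mulrC.
Qed.

(** A one-sided growth condition bounds the derivative.  All that is used about
    the gradient of N follows from this lemma: that it is a subgradient of dual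
    norm 1, first-order optimality conditions, and the existence of descent
    steps. *)
Lemma le_dot_ell p z (c : R) : p != 0 ->
  (forall h, 0 < h < 1 -> N p + h * c <= N (p + h *: z)) ->
  c <= dot (ell N p) z.
Proof.
move=> p0 Hc; rewrite dot_ellE//.
have /cvg_dnbhs_at_right dz : derivable N p z by exact/diff_derivable/N_diff.
apply: cvgr_to_ge dz _; near=> h.
have h0 : 0 < h by near: h; exact: nbhs_right_gt.
have h1 : h < 1 by near: h; exact: nbhs_right_lt.
rewrite /= [leRHS]mulrC ler_pdivlMr// lerBrDl mulrC [h *: z + p]addrC.
by apply: Hc; rewrite h0 h1.
Unshelve. all: by end_near. Qed.

(** By the triangle inequality N p <= N (p - h z) + h N z, so the derivative
    along - z is at least - N z. *)
Lemma dot_ell_le p z : p != 0 -> dot (ell N p) z <= N z.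
Proof.
move=> p0; rewrite -[leLHS]opprK -dotNr lerNl.
apply: le_dot_ell => // h /andP[h0 _].
have := norm_triangle N_norm (p + h *: - z) (h *: z).
rewrite -addrA -scalerDr addNr scaler0 addr0 (normZ_ge0 N_norm _ (ltW h0)).
lra.
Qed.

Lemma dot_ell_self p : p != 0 -> dot (ell N p) p = N p.
Proof.
move=> p0; apply/le_anti; rewrite dot_ell_le//=.
apply: le_dot_ell => // h /andP[h0 _].
rewrite -{3}[p]scale1r -scalerDl (normZ_ge0 N_norm) ?addr_ge0 ?(ltW h0)//.
by rewrite mulrDl mul1r.
Qed.

Lemma ell_neq0 p : p != 0 -> ell N p != 0.
Proof.
move=> p0; apply/eqP => lp0; move: (dot_ell_self p0); rewrite lp0 dot0l => /esym.
by move=> /(norm_definite N_norm)/eqP; rewrite (negPf p0).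
Qed.

(** Half of the invariance of the gradient under positive scaling: the gradient
    w at p satisfies w.v <= N v for all v and w.u = N u at u = p / N p, so it
    is a subgradient of N at u, where the derivative dominates it. *)
Lemma dot_ell_normalize p z : p != 0 ->
  dot (ell N p) z <= dot (ell N ((N p)^-1 *: p)) z.
Proof.
move=> p0; have Np0 : 0 < N p by rewrite norm_gt0.
apply: le_dot_ell => [|h /andP[h0 _]].
  by rewrite scaler_eq0 invr_eq0 negb_or gt_eqF.
apply: (le_trans _ (dot_ell_le _ p0)); rewrite dotDr !dotZr dot_ell_self//.
by rewrite (normZ_ge0 N_norm)// invr_ge0 ltW.
Qed.

(** If no b in [0, 1] gave a decrease, then the derivative along - z would be
    nonnegative. *)
Lemma norm_descent p z : p != 0 -> 0 < dot (ell N p) z ->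
  exists2 b : R, 0 <= b <= 1 & N (p - b *: z) < N p.
Proof.
move=> p0 lz; apply: contrapT => nobeta; move: lz; apply/negP.
rewrite -leNgt.
rewrite -oppr_ge0 -dotNr; apply: le_dot_ell => // h /andP[h0 h1].
rewrite mulr0 addr0 scalerN leNgt; apply/negP => lt_h.
by apply: nobeta; exists h => //; rewrite !ltW.
Qed.

Lemma dual_norm_ell p : p != 0 -> dual_norm N (ell N p) = 1.
Proof.
move=> p0; have Np0 : 0 < N p by rewrite norm_gt0.
have ub1 : ubound [set dot (ell N p) x | x in [set x | N x <= 1]] 1.
  by move=> _ [x /= Nx <-]; exact: le_trans (dot_ell_le _ p0) Nx.
have in1 : [set dot (ell N p) x | x in [set x | N x <= 1]] 1.
  exists ((N p)^-1 *: p) => /=.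
    by rewrite (normZ_ge0 N_norm) ?mulVf ?gt_eqF// invr_ge0 ltW.
  by rewrite dotZr dot_ell_self// mulVf ?gt_eqF.
apply/le_anti; rewrite ge_sup//=; last by exists 1.
by apply: ub_le_sup => //; exists 1.
Qed.

End gradient_of_norm.

(** * Margins and dual certificates *)

Section margins.
Context {R : realType} {d : nat} {N : 'rV[R]_d -> R}.
Hypothesis N_norm : is_norm N.
Implicit Types (w p q v : 'rV[R]_d) (V : set 'rV[R]_d).

(** The supremum of a set unbounded above is 0 by convention, so a nonzero value
    certifies that the supremum defining the dual norm is finite. *)
Lemma dot_le_dual_norm w z : dual_norm N w != 0 ->
  0 < dual_norm N w /\ dot w z <= dual_norm N w * N z.
Proof.
rewrite /dual_norm; set S := [set _ | _ in _] => S0.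
have [_ Sub] : has_sup S by apply: contrapT => /sup_out /eqP; rewrite (negPf S0).
have sup_gt0 : 0 < sup S.
  rewrite lt_def S0; apply: ub_le_sup => //.
  by exists 0 => /=; rewrite ?dot0r// (norm0 N_norm).
split=> //; have [->|z0] := eqVneq z 0; first by rewrite dot0r (norm0 N_norm) mulr0.
have Nz0 : 0 < N z by rewrite (norm_gt0 N_norm).
rewrite -ler_pdivrMr// mulrC -dotZr; apply: ub_le_sup => //.
exists ((N z)^-1 *: z) => //=.
by rewrite (normZ_ge0 N_norm) ?mulVf ?gt_eqF// invr_ge0 ltW.
Qed.

(** Weak duality.  A positive margin m puts the hulls in the half-spaces
    w.p + b >= m |w| and w.q + b <= - m |w|, with |w| the dual norm;
    subtracting, 2 m |w| <= w.(p - q) <= |w| N (p - q). *)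
Lemma margin_separates Vp Vm w b (m : R) : 0 < m -> Vp !=set0 ->
  (forall v, Vp v -> m <= margin N v 1 w b) ->
  (forall v, Vm v -> m <= margin N v (-1) w b) ->
  forall p q, conv_hull Vp p -> conv_hull Vm q -> m * 2 <= N (p - q).
Proof.
move=> m0 [v0 Vv0] mp mm p q Hp Hq.
have dn0 : dual_norm N w != 0.
  apply: contraL (lt_le_trans m0 (mp _ Vv0)) => /eqP dn0.
  by rewrite /margin dn0 invr0 mulr0 ltxx.
have [dn_gt0 dnle] := dot_le_dual_norm (p - q) dn0.
(* As m > 0, the maximum with 0 in the margin is attained by the other term. *)
have unmax a : m <= Num.max 0 a / dual_norm N w -> m * dual_norm N w <= a.
  rewrite ler_pdivlMr// le_max => /orP[|//].
  by rewrite leNgt mulr_gt0.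
have wp : m * dual_norm N w - b <= dot w p.
  move: p Hp {dnle}.
  apply: (@conv_hull_min _ _ _ [set p | m * dual_norm N w - b <= dot w p]).
    exact: halfspace_convex.
  by move=> v /mp /unmax /=; lra.
have wq : m * dual_norm N w + b <= dot (- w) q.
  move: q Hq {dnle}.
  apply: (@conv_hull_min _ _ _ [set q | m * dual_norm N w + b <= dot (- w) q]).
    exact: halfspace_convex.
  by move=> v /mm /unmax /=; rewrite dotNl; lra.
rewrite -(ler_pM2r dn_gt0) [leRHS]mulrC; apply: le_trans dnle.
by move: wq; rewrite dotBr dotNl; lra.
Qed.

Hypothesis N_diff : differentiable_off0 N.

(** First-order optimality: moving a certificate towards a point of its hull
    cannot shorten the difference, whose gradient thus separates the hulls. *)
Lemma dual_certificates_optimal Vp Vm vp vm : vp != vm ->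
  dual_certificates N Vp Vm vp vm ->
  (forall v, Vp v -> 0 <= dot (ell N (vp - vm)) (v - vp)) /\
  (forall v, Vm v -> 0 <= dot (ell N (vp - vm)) (vm - v)).
Proof.
rewrite -subr_eq0 => p0 [Hp Hm Hmin].
split=> v /sub_conv_hull Hv; apply: (le_dot_ell N_diff) => // h /andP[h0 h1].
- rewrite mulr0 addr0 addrAC; apply: Hmin => //.
  by apply: conv_hull_segment => //; rewrite !ltW.
- rewrite mulr0 addr0 -[vm - v]opprB scalerN -addrA -opprD; apply: Hmin => //.
  by apply: conv_hull_segment => //; rewrite !ltW.
Qed.

(** Strong duality.  Weak duality gives one inequality; for the other, the
    classifier with gradient w and the bias that bisects the certificates
    attains the value, by first-order optimality. *)
Lemma set_margin_certificates Vp Vm vp vm : Vp !=set0 -> vp != vm ->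
  dual_certificates N Vp Vm vp vm ->
  set_margin N Vp Vm = N (vp - vm) / 2.
Proof.
move=> Vp0 vpm cert; have [Hp Hm Hmin] := cert.
have p0 : vp - vm != 0 by rewrite subr_eq0.
have [optp optm] := dual_certificates_optimal vpm cert.
rewrite /set_margin; set S := [set _ | _ in _].
have Sub : ubound S (N (vp - vm) / 2).
  move=> _ [[w b] /= w0 <-]; rewrite leNgt; apply/negP => lt_m.
  set m := inf _ in lt_m.
  have m0 : 0 < m by apply: le_lt_trans lt_m; rewrite divr_ge0 ?(norm_ge0 N_norm).
  have [_ Llb] : has_inf (labelled_margins N Vp Vm w b).
    by apply: contrapT => /inf_out m_eq0; rewrite /m m_eq0 ltxx in m0.
  suff : m * 2 <= N (vp - vm) by move: lt_m; lra.
  apply: (@margin_separates Vp Vm w b) => // v Vv; apply: ge_inf => //.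
    by left; exists v.
  by right; exists v.
set w := ell N (vp - vm) in optp optm.
pose b := - (2^-1 * dot w (vp + vm)).
have Swb : S (inf (labelled_margins N Vp Vm w b)).
  by exists (w, b) => //=; exact: ell_neq0.
apply/le_anti; rewrite ge_sup//=; last by exists (inf (labelled_margins N Vp Vm w b)).
apply: (@le_trans _ _ (inf (labelled_margins N Vp Vm w b))); last first.
  by apply: ub_le_sup => //; exists (N (vp - vm) / 2).
have wE : dot w vp - dot w vm = N (vp - vm) by rewrite -dotBr dot_ell_self.
apply: lb_le_inf => [|_ [[v Vv <-]|[v Vv <-]]].
- by have [v Vv] := Vp0; exists (margin N v 1 w b); left; exists v.
- rewrite /margin dual_norm_ell// divr1 le_max; apply/orP; right.
  by move: (optp _ Vv); rewrite /b dotBr dotDr; lra.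
- rewrite /margin dual_norm_ell// divr1 le_max; apply/orP; right.
  by move: (optm _ Vv); rewrite /b dotBr dotDr; lra.
Qed.

End margins.

(** * The contraction factor *)

Section contraction_factor.
Context {R : realType} {d : nat} {N : 'rV[R]_d -> R}.
Hypothesis N_norm : is_norm N.

(** The value b = 0 gives N u = 1. *)
Lemma kappa_circ_le1 (delta eta : R) : (kappa_circ N delta eta <= 1)%E.
Proof.
apply: ge_ereal_sup => _ [[u z] /= [Nu1 _ _] <-].
rewrite lee_fin -[leRHS]Nu1; apply: ge_inf.
  by exists 0 => _ [b _ <-]; exact: norm_ge0.
exists 0; last by rewrite scale0r subr0.
by rewrite /= in_itv/= lexx ler01.
Qed.

Hypothesis N_diff : differentiable_off0 N.

(** The feasible pair is (p / N p, z / N p), and the hypothesis 2 g <= N p turns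
    N z <= D into a bound on the scaled vector by (D / g) / 2. *)
Lemma le_kappa (p p' z : 'rV[R]_d) (g D phi : R) :
  0 < g -> 2 * g <= N p -> N z <= D ->
  (1 - phi) * N p <= 2 * dot (ell N p) z ->
  (forall b, 0 <= b <= 1 -> N p' <= N (p - b *: z)) ->
  ((N p' / N p)%:E <= kappa N (D / g) phi)%E.
Proof.
move=> g0 gp zD etaz p'_le.
have Np0 : 0 < N p by lra.
have p0 : p != 0 by rewrite -(norm_gt0 N_norm).
have iNp : 0 <= (N p)^-1 by rewrite invr_ge0 ltW.
pose u := (N p)^-1 *: p; pose z' := (N p)^-1 *: z.
apply: (@le_trans _ _ (inf [set N (u - b *: z') | b in `[0 : R, 1]%classic])%:E).
  rewrite lee_fin; apply: lb_le_inf.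
    by exists (N (u - 0 *: z')); exists 0; rewrite //= in_itv/= lexx ler01.
  move=> _ [b + <-]; rewrite /= in_itv/= => b01.
  rewrite /u /z' scalerA [b * _]mulrC -scalerA -scalerBr (normZ_ge0 N_norm)//.
  rewrite [leRHS]mulrC.
  by rewrite ler_wpM2r// p'_le.
apply: ereal_sup_ubound; exists (u, z') => //=; split.
- by rewrite (normZ_ge0 N_norm)// mulVf ?gt_eqF.
- rewrite (normZ_ge0 N_norm)// mulrC ler_pdivrMr//.
  apply: (le_trans zD); have D0 : 0 <= D by exact: le_trans (norm_ge0 N_norm z) zD.
  rewrite -[leLHS](mulfVK (lt0r_neq0 g0)) -[leRHS]mulrA; apply: ler_wpM2l => //.
    by rewrite divr_ge0// ltW.
  lra.
- rewrite dotZr; apply: (@le_trans _ _ ((N p)^-1 * dot (ell N p) z)); last first.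
    by rewrite ler_wpM2l// dot_ell_normalize.
  by rewrite [leRHS]mulrC ler_pdivlMr//; lra.
Qed.

End contraction_factor.

(** * Counting the drops of a nonincreasing sequence *)

Section counting_descents.
Context {R : realType}.

(** Bounding the finite subfamilies of S also covers infinite S: their sizes are
    then unbounded, which forces c = +oo. *)
Lemma counting_le (T : choiceType) (S : set T) (c : \bar R) :
  (forall s : seq T, uniq s -> (forall t, t \in s -> S t) ->
    ((size s)%:R%:E <= c)%E) ->
  (counting S <= c)%E.
Proof.
move=> Hc; rewrite /counting; case: asboolP => [finS|infS].
  apply: Hc => [|t]; first exact: finmap.fset_uniq.
  by rewrite in_fset_set// => /set_mem.
have big n : (n%:R%:E <= c)%E.
  have [B BS nB] := infinite_set_fset n infS.
  apply: (le_trans _ (Hc (finmap.enum_fset B) (finmap.fset_uniq B) _)).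
    by rewrite lee_fin ler_nat.
  by move=> t tB; exact: BS.
case: c {Hc} big => [c|//|] big; last by have := big 0%N; rewrite leeNy_eq.
have c0 : 0 <= c by have := big 0%N; rewrite lee_fin.
by have := big (Num.bound c); rewrite lee_fin leNgt archi_boundP.
Qed.

(** Each index in S costs q, and the total cost cannot exceed the initial
    height because f stays nonnegative. *)
Lemma descent_count (f : nat -> R) (q : R) (S : set nat) (n0 : nat) :
  (forall t, (n0 <= t)%N -> 0 <= f t) ->
  (forall t, (n0 <= t)%N -> f t.+1 <= f t) ->
  (forall t, (n0 <= t)%N -> S t -> f t.+1 <= f t - q) ->
  forall s, uniq s -> (forall t, t \in s -> (n0 <= t)%N /\ S t) ->
  (size s)%:R * q <= f n0.
Proof.
move=> f_ge0 f_dec f_drop s s_uniq sS.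
(* The bound before n0 + k keeps the current height f (n0 + k), which makes it
   provable by induction on k. *)
suff H k : forall s, uniq s ->
    (forall t, t \in s -> [/\ (n0 <= t)%N, (t < n0 + k)%N & S t]) ->
    (size s)%:R * q + f (n0 + k)%N <= f n0.
  have := H (\max_(t <- s) t).+1 s s_uniq.
  have := f_ge0 (n0 + (\max_(t <- s) t).+1)%N (leq_addr _ _).
  set F := f (_ + _)%N => F0 H1; suff : (size s)%:R * q + F <= f n0 by lra.
  apply: H1 => t ts; have [n0t St] := sS _ ts; split => //.
  by rewrite addnS ltnS (leq_trans _ (leq_addl _ _))// (leq_bigmax_seq t).
elim: k => {s s_uniq sS} [|k IH] s s_uniq sS.
  case: s s_uniq sS => [|t s] _ sS; first by rewrite mul0r add0r addn0.
  have [|n0t tn0 _] := sS t; first exact: mem_head.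
  by rewrite addn0 ltnNge n0t in tn0.
have [ks|kNs] := boolP ((n0 + k)%N \in s).
  have [n0k _ Sk] := sS _ ks.
  have := f_drop _ n0k Sk; rewrite -addnS.
  have := IH (rem (n0 + k)%N s) (rem_uniq _ s_uniq).
  have := perm_size (perm_to_rem ks) => /= ->; rewrite -natr1 => H1.
  suff /H1 : forall t, t \in rem (n0 + k)%N s ->
    [/\ (n0 <= t)%N, (t < n0 + k)%N & S t] by lra.
  move=> t; rewrite (mem_rem_uniq _ s_uniq) inE => /andP[tk /sS[n0t]].
  by rewrite addnS ltnS leq_eqVlt (negPf tk).
apply: le_trans (IH s s_uniq _).
  by rewrite lerD2l addnS; apply: f_dec; exact: leq_addr.
move=> t ts; have [n0t + St] := sS _ ts; rewrite addnS ltnS leq_eqVlt.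
by move=> /orP[/eqP tE|//]; rewrite -tE ts in kNs.
Qed.

End counting_descents.

(** * One iteration of the algorithm *)

Section certified_states.
Context {R : realType} {d : nat} {N : 'rV[R]_d -> R}.
Hypotheses (N_norm : is_norm N) (N_diff : differentiable_off0 N).
Variables (P M : set 'rV[R]_d) (g : R).
Hypotheses (g_gt0 : 0 < g)
  (gap : forall p q, conv_hull P p -> conv_hull M q -> g * 2 <= N (p - q)).
Implicit Types (st : @state R d) (xt : 'rV[R]_d) (yt : R).

(** The invariant of the runs.  In the efficient implementation the stored sets
    contain former certificates, which need not be stream points; so the sets
    are only required to lie in the hulls of P and M. *)
Definition certified st : Prop :=
  [/\ st_Vp st !=set0, st_Vp st `<=` conv_hull P, st_Vm st `<=` conv_hull M,
      dual_certificates N (st_Vp st) (st_Vm st) (st_vp st) (st_vm st) &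
      st = build_state N (st_Vp st) (st_Vm st) (st_vp st) (st_vm st)].

Definition normal st : 'rV[R]_d := st_vp st - st_vm st.

(** Oriented so that an update on (xt, yt) lets the difference of the two hulls
    reach normal st - b *: inward st xt yt, whichever the label. *)
Definition inward st xt yt : 'rV[R]_d :=
  if yt == 1 then st_vp st - xt else xt - st_vm st.

Lemma certified_gap st : certified st -> g * 2 <= N (normal st).
Proof.
move=> [_ VP VM [Hp Hm _] _].
by apply: gap; [exact: (conv_hullS VP)|exact: (conv_hullS VM)].
Qed.

Lemma certified_neq0 st : certified st -> normal st != 0.
Proof.
move=> /certified_gap; rewrite -(norm_gt0 N_norm); apply: lt_le_trans.
by rewrite mulr_gt0.
Qed.

Lemma certified_gammaE st : certified st -> st_gamma st = N (normal st) / 2.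
Proof.
move=> cst; have := certified_neq0 cst; rewrite subr_eq0 => vpm.
have [Vp0 _ _ cert ->] := cst.
exact: set_margin_certificates.
Qed.

Lemma certified_wE st : certified st -> st_w st = ell N (normal st).
Proof. by move=> [_ _ _ _ ->]. Qed.

Lemma gap_le_gamma st : certified st -> g <= st_gamma st.
Proof.
by move=> cst; rewrite certified_gammaE//; have := certified_gap cst; lra.
Qed.

Lemma neq_opp1 : (-1 == 1 :> R) = false.
Proof. by apply/eqP; lra. Qed.

(** The bias bisects the certificates, whose scores are hence both gamma; this
    one identity lets the rest of the argument ignore the labels. *)
Lemma certified_score st xt yt : certified st -> yt = 1 \/ yt = -1 ->
  score st xt yt = st_gamma st - dot (ell N (normal st)) (inward st xt yt).
Proof.
move=> cst yt01; rewrite certified_gammaE// /score certified_wE//.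
have -> : st_b st = - (2^-1 * dot (ell N (normal st)) (st_vp st + st_vm st)).
  by have [_ _ _ _ ->] := cst.
have := dot_ell_self N_norm N_diff (certified_neq0 cst).
set w := ell N _; rewrite /normal /inward dotBr dotDr => <-.
by case: yt01 => ->; rewrite ?eqxx ?neq_opp1 dotBr; lra.
Qed.

Lemma certified_margin st xt yt (phi : R) : certified st ->
  yt = 1 \/ yt = -1 ->
  margin N xt yt (st_w st) (st_b st) <= phi * st_gamma st ->
  score st xt yt <= phi * st_gamma st /\
  (1 - phi) * N (normal st) <=
    2 * dot (ell N (normal st)) (inward st xt yt).
Proof.
move=> cst yt01; rewrite /margin [X in dual_norm _ X]certified_wE//.
rewrite dual_norm_ell ?certified_neq0// divr1 ge_max => /andP[_ le_phi].
split=> //; move: le_phi; rewrite -/(score st xt yt) certified_score//.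
by rewrite (certified_gammaE cst); lra.
Qed.

(** What the naive and the efficient updates have in common: the hulls still
    contain the old certificates, and one of them gains the new point. *)
Lemma new_sets_hull impl st xt yt : certified st ->
  (if yt == 1 then P xt else M xt) ->
  let V := new_sets impl st xt yt in
  [/\ V.1 !=set0, V.1 `<=` conv_hull P, V.2 `<=` conv_hull M,
      conv_hull V.1 (st_vp st) /\ conv_hull V.2 (st_vm st) &
      if yt == 1 then V.1 xt else V.2 xt].
Proof.
move=> [[v Vv] VP VM [Hp Hm _] _] Hx.
pose A := match impl with Naive => (st_Vp st, st_Vm st)
                        | Efficient => ([set st_vp st], [set st_vm st]) end.
have [A0 AP AM [Ap Am]] : [/\ A.1 !=set0, A.1 `<=` conv_hull P,
    A.2 `<=` conv_hull M & conv_hull A.1 (st_vp st) /\ conv_hull A.2 (st_vm st)].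
  rewrite /A; case: impl {A} => /=.
    by split=> //; exists v.
  split; first by exists (st_vp st).
  - by move=> _ ->; exact: (conv_hullS VP).
  - by move=> _ ->; exact: (conv_hullS VM).
  - by split; exact: sub_conv_hull.
have hullU (B : set 'rV[R]_d) p : conv_hull B p -> conv_hull (B `|` [set xt]) p.
  by apply: conv_hullS => q Bq; apply: sub_conv_hull; left.
have -> : new_sets impl st xt yt =
    if yt == 1 then (A.1 `|` [set xt], A.2) else (A.1, A.2 `|` [set xt]).
  by rewrite /A; case: impl {A A0 AP AM Ap Am}.
case: ifP Hx => _ Hx /=; split => //; try (by right).
- by have [a Aa] := A0; exists a; left.
- by move=> p [/AP//|->]; exact: sub_conv_hull.
- by split => //; exact: hullU.
- by move=> p [/AM//|->]; exact: sub_conv_hull.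
- by split => //; exact: hullU.
Qed.

Lemma step_update impl (rho : R) st xt yt st' : certified st ->
  (if yt == 1 then P xt else M xt) ->
  step N impl rho st xt yt st' ->
  score st xt yt < rho * st_gamma st ->
  certified st' /\ forall b, 0 <= b <= 1 ->
    N (normal st') <= N (normal st - b *: inward st xt yt).
Proof.
move=> cst Hx + upd; rewrite /step upd => -[vp [vm [cert ->]]].
have := new_sets_hull impl cst Hx.
move: cert; set V := new_sets _ _ _ _ => -[cp cm cmin] [V0 VP VM [Vp Vm] Vx].
split=> [|b b01]; first by split.
rewrite /normal /inward; case: ifP Vx => _ Vx.
- have -> : st_vp st - st_vm st - b *: (st_vp st - xt) =
      st_vp st + b *: (xt - st_vp st) - st_vm st.
    by rewrite -[st_vp st - xt]opprB scalerN opprK addrAC.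
  apply: cmin => //; apply: conv_hull_segment => //.
  exact: sub_conv_hull.
- have -> : st_vp st - st_vm st - b *: (xt - st_vm st) =
      st_vp st - (st_vm st + b *: (xt - st_vm st)).
    by rewrite opprD addrA.
  apply: cmin => //; apply: conv_hull_segment => //.
  exact: sub_conv_hull.
Qed.

Lemma step_certified impl (rho : R) st xt yt st' : certified st ->
  (if yt == 1 then P xt else M xt) ->
  step N impl rho st xt yt st' ->
  certified st' /\ st_gamma st' <= st_gamma st.
Proof.
move=> cst Hx Hst; have [upd|noupd] := ltP (score st xt yt) (rho * st_gamma st).
  have [cst' le_b] := step_update cst Hx Hst upd.
  split=> //; rewrite !certified_gammaE// ler_pM2r//.
  by have := le_b 0; rewrite scale0r subr0; apply; rewrite lexx ler01.
by move: Hst; rewrite /step ltNge noupd => ->.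
Qed.

Variable D : R.
Hypotheses (diamP : forall p q, P p -> P q -> N (p - q) <= D)
  (diamM : forall p q, M p -> M q -> N (p - q) <= D).

Lemma inward_le_diam st xt yt : certified st ->
  (if yt == 1 then P xt else M xt) -> N (inward st xt yt) <= D.
Proof.
move=> [_ VP VM [Hp Hm _] _]; rewrite /inward; case: ifP => _ Hx.
  exact: (conv_hull_diam N_norm diamP (conv_hullS VP Hp) Hx).
rewrite -opprB (normN N_norm).
exact: (conv_hull_diam N_norm diamM (conv_hullS VM Hm) Hx).
Qed.

(** With w the gradient, (1 - phi) g <= w.z <= N z <= D for z the inward
    displacement. *)
Lemma violation_diam (phi : R) st xt yt : certified st ->
  (if yt == 1 then P xt else M xt) -> phi < 1 ->
  (1 - phi) * N (normal st) <=
    2 * dot (ell N (normal st)) (inward st xt yt) ->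
  1 - phi <= D / g.
Proof.
move=> cst Hx phi1 Hz; rewrite ler_pdivlMr//.
have gN := certified_gap cst.
have := inward_le_diam cst Hx.
have := dot_ell_le N_norm N_diff (inward st xt yt) (certified_neq0 cst).
by nra.
Qed.

Lemma violation_contraction impl (rho phi : R) st xt yt st' : certified st ->
  (if yt == 1 then P xt else M xt) -> phi < 1 ->
  step N impl rho st xt yt st' ->
  score st xt yt < rho * st_gamma st ->
  (1 - phi) * N (normal st) <=
    2 * dot (ell N (normal st)) (inward st xt yt) ->
  st_gamma st' < st_gamma st /\
  ((st_gamma st' / st_gamma st)%:E <= kappa N (D / g) phi)%E.
Proof.
move=> cst Hx phi1 Hst upd Hz.
have [cst' le_b] := step_update cst Hx Hst upd.
have gN := certified_gap cst.
rewrite !certified_gammaE//; split.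
  have [|b b01] := norm_descent N_diff (z := inward st xt yt) (certified_neq0 cst).
    have : 0 < (1 - phi) * N (normal st).
      by rewrite mulr_gt0 ?subr_gt0// (norm_gt0 N_norm) certified_neq0.
    by move=> /lt_le_trans/(_ Hz); rewrite pmulr_rgt0.
  by move=> lt_b; rewrite ltr_pM2r//; exact: le_lt_trans (le_b _ b01) lt_b.
rewrite -mulf_div divff ?mulr1 ?pnatr_eq0//.
apply: (le_kappa N_norm N_diff (z := inward st xt yt)) => //.
  by rewrite mulrC.
exact: inward_le_diam.
Qed.

End certified_states.

(** * The stream *)

Section stream_facts.
Context {R : realType} {d : nat} {N : 'rV[R]_d -> R}.
Hypothesis N_norm : is_norm N.
Variables (x : nat -> 'rV[R]_d) (y : nat -> R).

Definition points_labelled (l : R) : set 'rV[R]_d :=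
  [set x s | s in [set s | y s = l]].

Lemma stream_gap (w : 'rV[R]_d) (b : R) :
  (exists s, y s = 1) -> 0 < stream_margin N x y w b ->
  forall p q, conv_hull (points_labelled 1) p ->
    conv_hull (points_labelled (-1)) q ->
    stream_margin N x y w b * 2 <= N (p - q).
Proof.
move=> [s ys] m0.
(* The infimum of a set without one is 0 by convention. *)
have [_ mlb] : has_inf (range (fun s => margin N (x s) (y s) w b)).
  apply: contrapT => /inf_out; rewrite -/(stream_margin N x y w b) => m_eq0.
  by rewrite m_eq0 ltxx in m0.
have le_m t : stream_margin N x y w b <= margin N (x t) (y t) w b.
  by apply: ge_inf => //; exists t.
apply: (@margin_separates _ _ _ N_norm _ _ w b) => //.
- by exists (x s), s.
- by move=> _ [t /= yt <-]; rewrite -yt.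
- by move=> _ [t /= yt <-]; rewrite -yt.
Qed.

Lemma label_diam_ge (l : R) p q : has_ubound (label_dists N x y l) ->
  points_labelled l p -> points_labelled l q -> N (p - q) <= label_diam N x y l.
Proof.
move=> ub [s ys <-] [t yt <-]; apply: ub_le_sup => //.
by exists (s, t).
Qed.

Hypothesis y_pm1 : forall s, y s = 1 \/ y s = -1.

Lemma stream_point_labelled s :
  if y s == 1 then points_labelled 1 (x s) else points_labelled (-1) (x s).
Proof.
by case: (y_pm1 s) => ys; rewrite ys ?eqxx ?neq_opp1; exists s.
Qed.

Lemma init_certified s0 : first_opposite y s0 ->
  certified (N := N) (points_labelled 1) (points_labelled (-1))
    (init_state N x y s0).
Proof.
move=> [ys0 _].
suff H vp vm : points_labelled 1 vp -> points_labelled (-1) vm ->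
    certified (N := N) (points_labelled 1) (points_labelled (-1))
      (build_state N [set vp] [set vm] vp vm).
  rewrite /init_state; apply: H.
    case: eqP => y0; first by exists 0%N.
    by exists s0; case: (y_pm1 s0) (y_pm1 0) => [//|ys] []//; congruence.
  case: eqP => y0; last by exists 0%N; case: (y_pm1 0).
  by exists s0; case: (y_pm1 s0) => // ys; case: ys0; rewrite ys y0.
move=> Pp Mm; split => //=.
- by exists vp.
- by move=> _ ->; exact: sub_conv_hull.
- by move=> _ ->; exact: sub_conv_hull.
- split; [exact: sub_conv_hull|exact: sub_conv_hull|].
  by move=> p q /conv_hull1 -> /conv_hull1 ->.
Qed.

End stream_facts.

(** * The bound on the number of violations *)

Theorem theorem4p1 (R : realType) (d : nat) (d_gt0 : (0 < d)%N)
  (N : 'rV[R]_d -> R)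
  (N_norm : is_norm N)
  (N_strict : strictly_convex_norm N)
  (N_diff : differentiable_off0 N)
  (x : nat -> 'rV[R]_d) (y : nat -> R)
  (y_pm1 : forall s, y s = 1 \/ y s = -1)
  (y_both : (exists s, y s = 1) /\ (exists s, y s = -1))
  (w_star : 'rV[R]_d) (b_star : R)
  (star_max : max_margin_classifier N x y w_star b_star)
  (gamma_star : R)
  (gamma_starE : gamma_star = stream_margin N x y w_star b_star)
  (gamma_star_gt0 : 0 < gamma_star)
  (Dp_fin : has_ubound (label_dists N x y 1))
  (Dm_fin : has_ubound (label_dists N x y (-1)))
  (x_bounded : has_ubound (range (fun s => N (x s))))
  (D r : R)
  (DE : D = stream_diam N x y)
  (rE : r = D / gamma_star)
  (rho : R) (rho01 : 0 <= rho <= 1)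
  (impl : implementation)
  (s0 : nat) (s0_first : first_opposite y s0)
  (st : nat -> state)
  (st_run : omm_run N impl rho x y s0 st) :
  forall phi : R, phi <= rho -> phi < 1 ->
    (phi = rho -> no_ties rho x y s0 st) ->
    (violations N x y s0 st phi
       <= violation_bound N r (st_gamma (st 3%N)) gamma_star phi)%E.
Proof.
move=> phi phi_rho phi1 ties.
pose P := points_labelled x y 1; pose M := points_labelled x y (-1).
have gap p q : conv_hull P p -> conv_hull M q -> gamma_star * 2 <= N (p - q).
  rewrite gamma_starE; apply: stream_gap => //; first by case: y_both.
  by rewrite -gamma_starE.
have diamP p q : P p -> P q -> N (p - q) <= D.
  by move=> Pp Pq; rewrite DE le_max (label_diam_ge Dp_fin).
have diamM p q : M p -> M q -> N (p - q) <= D.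
  by move=> Mp Mq; rewrite DE le_max (label_diam_ge Dm_fin) ?orbT.
pose xt := received s0 x; pose yt := received s0 y.
have labelled t : if yt t == 1 then P (xt t) else M (xt t).
  exact: stream_point_labelled.
have yt_pm1 t : yt t = 1 \/ yt t = -1 by exact: y_pm1.
have [st3 st_step] := st_run.
have cst t : (3 <= t)%N -> certified (N := N) P M (st t).
  elim: t => // t IH; rewrite leq_eqVlt => /orP[/eqP <-|].
    by rewrite st3; exact: init_certified.
  rewrite ltnS => t3.
  by have [] := step_certified N_norm N_diff gamma_star_gt0 gap (IH t3)
    (labelled t) (st_step _ t3).
pose gam t := st_gamma (st t).
have gam_dec t : (3 <= t)%N -> gam t.+1 <= gam t.
  move=> t3; by have [] := step_certified N_norm N_diff gamma_star_gt0 gap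
    (cst _ t3) (labelled t) (st_step _ t3).
have gam_ge t : (3 <= t)%N -> gamma_star <= gam t.
  by move=> t3; exact: (gap_le_gamma N_norm N_diff gamma_star_gt0 gap (cst _ t3)).
have gam_gt0 t : (3 <= t)%N -> 0 < gam t.
  by move=> t3; exact: lt_le_trans (gam_ge t t3).
have gam_le3 k : gam (3 + k)%N <= gam 3%N.
  by elim: k => // k; apply: le_trans; rewrite addnS; exact: gam_dec.
rewrite /violations; set S := [set t | _].
have viol t : S t -> [/\ 1 - phi <= r, gam t.+1 < gam t &
    ((gam t.+1 / gam t)%:E <= kappa N r phi)%E].
  move=> [t3 le_phi].
  have [sc_phi Hz] := certified_margin N_norm N_diff gamma_star_gt0 gap
    (cst t t3) (yt_pm1 t) le_phi.
  (* A violation triggers an update; for phi = rho this needs the absence of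
     ties. *)
  have upd : score (st t) (xt t) (yt t) < rho * gam t.
    have := phi_rho; rewrite le_eqVlt => /orP[/eqP phiE|lt_phi].
      by rewrite lt_neqAle -{2}phiE sc_phi andbT; apply/eqP; exact: ties.
    by apply: le_lt_trans sc_phi _; rewrite ltr_pM2r// gam_gt0.
  have [strict contr] := violation_contraction N_norm N_diff gamma_star_gt0 gap
    diamP diamM (cst t t3) (labelled t) phi1 (st_step t t3) upd Hz.
  rewrite rE; split => //.
  exact: (violation_diam N_norm N_diff gamma_star_gt0 gap diamP diamM (cst t t3)
    (labelled t) phi1 Hz).
have no_viol (c : \bar R) : (forall t, ~ S t) -> (0 <= c)%E -> (counting S <= c)%E.
  move=> S0 c0; apply: counting_le => -[//|t s] _ /(_ t (mem_head _ _)).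
  by move/S0.
rewrite /violation_bound; have [lt_phi|ge_phi] := ltP phi (1 - r).
  by apply: no_viol => // t /viol[phi_r _ _]; lra.
rewrite -/(gam 3%N).
(* One violation is enough to make kappa a positive real number. *)
have [|/existsNP[t0 /contrapT St0]] := pselect (forall t, ~ S t).
  move=> S0; apply: no_viol => //; rewrite mule_ge0 ?inve_ge0 ?oppe_ge0 ?lne_le0//.
    by rewrite lee_fin ln_ge0// ler_pdivlMr// mul1r gam_ge.
  exact: kappa_circ_le1.
have [t3 _] := St0.
have [_ strict kap] := viol _ St0.
have kap_le1 : (kappa N r phi <= 1)%E by exact: kappa_circ_le1.
have : (0 < kappa N r phi)%E.
  by apply: lt_le_trans kap; rewrite lte_fin divr_gt0// gam_gt0// ltnW.
have kapS t : S t -> ((gam t.+1 / gam t)%:E <= kappa N r phi)%E by case/viol.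
case: (kappa N r phi) kap_le1 kapS {kap} => [k|//|//].
rewrite lee_fin lte_fin le_eqVlt => /orP[/eqP ->|k1] kapS k0.
  (* kappa = 1: the strict descent at t0 makes the numerator positive, and the
     bound is +oo. *)
  rewrite lne1 oppe0 inve0 gt0_muley ?leey// lte_fin ln_gt0//.
  rewrite ltr_pdivlMr// mul1r.
  apply: le_lt_trans (gam_ge _ (ltnW t3 : (3 <= t0.+1)%N)) _.
  by apply: lt_le_trans strict _; rewrite -(subnKC t3).
rewrite lne_EFin// -EFinN inver oppr_eq0 lt_eqF ?ln_lt0 ?k0//.
rewrite -EFinM; apply: counting_le => s s_uniq sS.
have q0 : 0 < - ln k by rewrite oppr_gt0 ln_lt0 ?k0.
rewrite lee_fin ler_pdivlMr//.
apply: (@descent_count _ (fun t => ln (gam t / gamma_star)) _ S 3%N) => //.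
- by move=> t t3'; rewrite ln_ge0// ler_pdivlMr// mul1r gam_ge.
- move=> t t3'; have t3S := leqW t3'.
  rewrite ler_ln ?posrE ?divr_gt0 ?gam_gt0//.
  by rewrite ler_pM2r ?invr_gt0// gam_dec.
- move=> t t3' St; rewrite opprK -lnM ?posrE ?divr_gt0 ?gam_gt0//.
  have t3S := leqW t3'.
  rewrite ler_ln ?posrE ?mulr_gt0 ?invr_gt0 ?gam_gt0//.
  rewrite mulrAC ler_pM2r ?invr_gt0// mulrC.
  by have := kapS _ St; rewrite lee_fin ler_pdivrMr// gam_gt0.
- by move=> t ts; have := sS _ ts => St; split => //; case: St.
Qed.
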